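(* For every graph $G$ of order $n \geq 17$, $\operatorname{md}(G) \leq n-6$. Moreover, this bound is sharp for an infinite family of graphs: there are infinitely many pairwise non-isomorphic graphs $G$ of order $n \ge 17$ with $\operatorname{md}(G) = n-6$.
   Context: All graphs are finite, simple and undirected, with nonempty vertex set; the order of $G$ is $n=|V(G)|$. Zero forcing: starting from a set $S\subseteq V(G)$ of blue vertices (all others uncolored), a blue vertex adjacent to exactly one uncolored vertex colors that neighbor blue (it ''forces'' it); this rule is applied repeatedly until no new vertex can be colored. The final set of blue vertices is the closure $\operatorname{cl}(S)$. $S$ is a zero forcing set if $\operatorname{cl}(S)=V(G)$. A zero forcing set is minimal if no proper subset of it is a zero forcing set. $Z(G)$ is the minimum cardinality of a zero forcing set, $\overline{Z}(G)$ is the maximum cardinality of a minimal zero forcing set, and $\operatorname{md}(G)=\overline{Z}(G)-Z(G)$. *)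

(* Defs.v *)
From HB Require Import structures.
From mathcomp Require Import all_boot.

Set Implicit Arguments.
Unset Strict Implicit.
Unset Printing Implicit Defensive.

Record sgraph := SGraph {
  vertex :> finType;
  adj : rel vertex;
  adj_sym : symmetric adj;
  adj_irrefl : irreflexive adj
}.

Definition graph_order (G : sgraph) : nat := #|G|.

Definition isomorphic (G H : sgraph) : Prop :=
  exists2 f : G -> H, bijective f & forall x y, adj (f x) (f y) = adj x y.

Section ZeroForcing.
Variable G : sgraph.
Implicit Types (S B : {set G}) (u v : G).

Definition nbhd u : {set G} := [set v | adj u v].

Definition forces B u v : bool := (u \in B) && (nbhd u :\: B == [set v]).

(* One round: every force available from the blue set B is performed.  The
   closure does not depend on the order of the forces, so rounds may be used
   in place of single forces (see zf_closure_stable and zf_closure_least). *)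
Definition zf_step B : {set G} := B :|: [set v | [exists u, forces B u v]].

(* Each round before stabilisation colors a new vertex, so #|G| rounds
   suffice. *)
Definition zf_closure S : {set G} := iter #|G| zf_step S.

Definition zero_forcing S : bool := zf_closure S == [set: G].

(* minset P A: A satisfies P and no proper subset of A does. *)
Definition minimal_zero_forcing S : bool := minset zero_forcing S.

(* [set: G] is a zero forcing set (zero_forcing_setT), so this is a genuine
   minimum. *)
Definition Z : nat := #|[arg min_(S < [set: G] | zero_forcing S) #|S|]|.

Definition Zbar : nat := \max_(S : {set G} | minimal_zero_forcing S) #|S|.

(* The truncated subtraction is exact, by Z_le_Zbar. *)
Definition md : nat := Zbar - Z.

Lemma zf_step_sub B : B \subset zf_step B.
Proof. exact: subsetUl. Qed.

Lemma zf_closure_sub S : S \subset zf_closure S.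
Proof.
rewrite /zf_closure; elim: #|G| => [|n IH] //=.
exact: subset_trans IH (zf_step_sub _).
Qed.

Lemma zf_closure_stable S u v :
  forces (zf_closure S) u v -> v \in zf_closure S.
Proof.
suff E : zf_step (zf_closure S) = zf_closure S.
  by move=> H; rewrite -E !inE; apply/orP; right; apply/existsP; exists u.
have grow n : zf_step (iter n zf_step S) = iter n zf_step S
              \/ n <= #|iter n zf_step S|.
  elim: n => [|n IH]; first by right.
  have [H|H] := eqVneq (zf_step (iter n zf_step S)) (iter n zf_step S).
    by left; rewrite iterS H H.
  case: IH => [E|IH]; first by rewrite E eqxx in H.
  right; apply: leq_ltn_trans IH _; apply: proper_card.
  by rewrite iterS properEneq eq_sym H zf_step_sub.
case: (grow #|G|) => // le_n; have {le_n} : zf_closure S = setT.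
  by apply/eqP; rewrite eqEcard subsetT cardsT.
by move=> ->; apply/eqP; rewrite eqEsubset subsetT zf_step_sub.
Qed.

Lemma zf_closure_least S B :
  S \subset B -> (forall u v, forces B u v -> v \in B) -> zf_closure S \subset B.
Proof.
move=> sSB stB; rewrite /zf_closure; elim: #|G| => [|n IH] //=.
rewrite subUset IH /=; apply/subsetP => v; rewrite inE.
case/existsP=> u /andP[uA /eqP NA]; apply/negPn/negP => vB.
case/negP: (vB); apply: (stB u); rewrite /forces (subsetP IH) //=.
rewrite eqEsubset -{1}NA setDS //= sub1set inE vB /=.
by move: (set11 v); rewrite -NA !inE => /andP[].
Qed.

Lemma zero_forcing_setT : zero_forcing [set: G].
Proof. by rewrite /zero_forcing eqEsubset subsetT zf_closure_sub. Qed.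

Lemma Z_le_Zbar : Z <= Zbar.
Proof.
rewrite /Z; case: arg_minnP; first exact: zero_forcing_setT.
move=> S zS minS; rewrite /Zbar (bigD1 S) /= ?leq_maxl //.
apply/minsetP; split=> // B zB sBS.
by apply/eqP; rewrite eqEcard sBS minS.
Qed.

End ZeroForcing.

(* Main.v *)
(* A set is zero forcing iff it meets every fort, a nonempty F such that no
   vertex outside F has exactly one neighbour in F.  Let S be a minimal zero
   forcing set with complement W and B a minimum one; the bound says
   |B| + |W| >= 6.  Every s in S lies in a fort contained in W + s, so two
   vertices of S with the same trace of size at most 1 on W are twins, and
   |B| + |W| bounds the number of vertices with such traces.  Hence if
   |B| + |W| <= 5 and n >= 17, many vertices have two neighbours in W.  This
   gives a biclique with one side of size |B| and a large other side, which
   cannot be forced from B.  The bound is attained by joining three vertices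
   a, b, x to a path and adding the edge ax: the complement of {a, b} is a
   minimal zero forcing set, and a, b, x and an end of the path force. *)
Require Import Defs.
From mathcomp Require Import all_boot.
From mathcomp Require Import zify.

Set Implicit Arguments.
Unset Strict Implicit.
Unset Printing Implicit Defensive.

Lemma disjointsU1 (T : finType) (x : T) (A B : {set T}) :
  [disjoint x |: A & B] = (x \notin B) && [disjoint A & B].
Proof. by rewrite !disjoints_subset subUset sub1set inE. Qed.

(** * Forts as the obstructions to zero forcing *)

Section Forts.
Variable G : sgraph.
Implicit Types (A S B F H Q M X : {set G}) (u v w s : G).

Definition fort F : bool :=
  (F != set0) && [forall v, (v \notin F) ==> (#|nbhd v :&: F| != 1)].

Lemma fortP F :
  reflect (F != set0 /\ forall v, v \notin F -> #|nbhd v :&: F| <> 1) (fort F).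
Proof.
apply: (iffP andP) => -[F0 FP]; split=> //.
  by move=> v vF; apply/eqP; exact: (implyP (forallP FP v)).
by apply/forallP => v; apply/implyP => vF; apply/eqP; exact: FP.
Qed.

Lemma zero_forcing_stable B X :
    zero_forcing B -> B \subset X -> (forall u v, forces X u v -> v \in X) ->
  X = setT.
Proof.
move=> /eqP zB sBX stX; apply/eqP; rewrite eqEsubset subsetT -zB.
exact: zf_closure_least.
Qed.

(** The complement of a fort is stable: a force out of it needs a vertex outside [F] with exactly
    one neighbour in [F]. *)
Lemma fort_meets_zero_forcing B F :
  zero_forcing B -> fort F -> ~~ [disjoint B & F].
Proof.
move=> zB /fortP[/set0Pn[x xF] FP]; apply/negP => dBF.
suff E : ~: F = setT by move: (in_setT x); rewrite -E inE xF.
apply: (zero_forcing_stable zB); first by rewrite -disjoints_subset.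
move=> u v /andP[uF /eqP E].
case: (FP u); first by rewrite inE in uF.
by rewrite -[F]setCK -setDE E cards1.
Qed.

(** The fort is what the closure of [B] leaves uncolored. *)
Lemma not_zero_forcing_fort B :
  ~~ zero_forcing B -> exists2 F, fort F & [disjoint B & F].
Proof.
move=> zB; exists (~: zf_closure B); last first.
  by rewrite disjoints_subset setCK zf_closure_sub.
apply/fortP; split; first by apply: contra zB => /eqP/(congr1 (@setC _)); rewrite setCK setC0 => /eqP.
move=> u; rewrite inE negbK => uB /eqP/cards1P[v]; rewrite -setDE => /eqP E.
have /zf_closure_stable vB : forces (zf_closure B) u v by rewrite /forces uB.
by move: (set11 v); rewrite -(eqP E) inE vB.
Qed.

Lemma twin_fort u v :
    u != v -> (forall y, y != u -> y != v -> adj y u = adj y v) ->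
  fort [set u; v].
Proof.
move=> neq_uv tw; apply/fortP; split; first by apply/set0Pn; exists u; rewrite set21.
move=> y; rewrite !inE negb_or => /andP[yu yv].
have := tw y yu yv; case yuE: (adj y u) => /esym yvE.
  suff -> : nbhd y :&: [set u; v] = [set u; v] by rewrite cards2 neq_uv.
  by apply/setIidPr/subsetP => x /set2P[] ->; rewrite inE.
suff -> : nbhd y :&: [set u; v] = set0 by rewrite cards0.
apply/setP => x; rewrite !inE; case: eqP => [->|_]; first by rewrite yuE.
by case: eqP => [->|_]; rewrite ?yvE ?andbF.
Qed.

Lemma fort2_adj u v y :
  u != v -> fort [set u; v] -> y != u -> y != v -> adj y u = adj y v.
Proof.
move=> neq_uv /fortP[_ FP] yu yv; move: (FP y); rewrite !inE negb_or yu yv => /(_ isT).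
case yuE: (adj y u); case yvE: (adj y v) => // -[]; apply/eqP/cards1P.
  exists u; apply/setP => x; rewrite !inE; case: eqP => [->|_]; first by rewrite yuE.
  by case: eqP => [->|_]; rewrite ?yvE ?andbF.
exists v; apply/setP => x; rewrite !inE; case: eqP => [->|_].
  by rewrite yuE (negPf neq_uv).
by case: eqP => [->|_]; rewrite ?yvE ?andbF.
Qed.

(** * The boundary of the blue set, and bicliques *)

Definition boundary X : {set G} := [set x in X | ~~ (nbhd x \subset X)].

(* Forcing v from u removes u from the boundary and adds at most v, so the
   boundary never outgrows the initial zero forcing set. *)
Lemma forcing_stage B H (j : nat) :
    zero_forcing B -> #|B| <= j -> j < #|H| ->
  exists X u v, [/\ #|boundary X| <= #|B|, #|X :&: H| = j, v \in H & forces X u v].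
Proof.
move=> zB leBj ltjH.
(* One force is performed at a time, [n] bounding the uncolored vertices, until the next one would
   raise [#|X :&: H|] above [j]. *)
suff grow n X : #|~: X| < n -> B \subset X -> #|boundary X| <= #|B| ->
    #|X :&: H| <= j ->
    exists X u v, [/\ #|boundary X| <= #|B|, #|X :&: H| = j, v \in H & forces X u v].
  apply: (grow _ B (ltnSn _)) => //.
    by apply: subset_leq_card; apply/subsetP => x; rewrite inE => /andP[].
  by apply: leq_trans leBj; exact: subset_leq_card (subsetIl _ _).
elim: n X => // n IH X ltXn sBX bX XH.
have [/existsP[u /existsP[v fuv]]|none] := boolP [exists u, exists v, forces X u v]; last first.
  have XT : X = setT.
    apply: (zero_forcing_stable zB sBX) => u v fuv.
    by case/negP: none; apply/existsP; exists u; apply/existsP; exists v.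
  by move: XH; rewrite XT setTI leqNgt ltjH.
have /andP[uX /eqP Nu] := fuv.
have /setDP[uv vX] : v \in nbhd u :\: X by rewrite Nu set11.
have [/andP[/eqP XHj vH]|notyet] := boolP ((#|X :&: H| == j) && (v \in H)).
  by exists X, u, v.
apply: (IH (v |: X)).
- rewrite setCU setIC -setDE (cardsD1 v (~: X)) inE vX /= in ltXn *; lia.
- exact: subset_trans sBX (subsetUr _ _).
- have uB : u \in boundary X.
    by rewrite inE uX; apply/subsetPn; exists v.
  apply: leq_trans bX; rewrite (cardsD1 u (boundary X)) uB add1n.
  apply: (leq_trans (n := #|v |: boundary X :\ u|)); last by rewrite cardsU1; case: (v \notin _) => /=; lia.
  apply: subset_leq_card; apply/subsetP => x; rewrite !inE => /andP[].
  case: eqP => //= _ xX xN; rewrite xX /=; apply/andP; split.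
    apply: contra xN => /eqP->; apply/subsetP => y yN.
    have [yX|yX] := boolP (y \in X); first by rewrite inE yX orbT.
    by have : y \in nbhd u :\: X by [rewrite inE yX]; rewrite Nu !inE => ->.
  by apply: contra xN => xN; exact: subset_trans xN (subsetUr _ _).
- have [vH|vH] := boolP (v \in H).
    move: notyet; rewrite vH andbT => ne.
    rewrite setIUl (setIidPl _) ?sub1set // cardsU1; case: (v \notin _); lia.
  suff -> : (v |: X) :&: H = X :&: H by [].
  by apply/setP => x; rewrite !inE; case: eqP => // ->; rewrite (negPf vH) !andbF.
Qed.

(** Otherwise stop when [#|Q|.+1] vertices of [Q :|: M] are blue and the next force colors another.
    If neither side is all blue, these vertices all lie on the boundary, which has at most [#|Q|]
    elements. If only [M] is all blue, [M] lies on the boundary and is too large. If [Q] is all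
    blue, it is the whole boundary, and each of its vertices still has two uncolored neighbours in
    [M], so none can force. *)
Lemma biclique_bound B Q M :
    zero_forcing B -> #|B| <= #|Q| ->
    (forall q m, q \in Q -> m \in M -> adj q m) ->
  #|M| <= maxn #|Q| 2.
Proof.
move=> zB leBQ QM; rewrite leqNgt; apply/negP; rewrite gtn_max => /andP[ltQM lt2M].
have dQM : Q :&: M = set0.
  apply/setP => x; rewrite !inE; apply/negP => /andP[xQ xM].
  by have := QM x x xQ xM; rewrite adj_irrefl.
have cQM X : #|X :&: (Q :|: M)| = #|X :&: Q| + #|X :&: M|.
  by rewrite setIUr cardsU setIACA dQM setI0 cards0 subn0.
have [||X [u [v [bX XH vH /andP[uX /eqP Nu]]]]] :=
  @forcing_stage B (Q :|: M) #|Q|.+1 zB.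
- exact: leqW.
- by rewrite cardsU dQM cards0; lia.
rewrite cQM in XH.
have actQ : ~~ (M \subset X) -> X :&: Q \subset boundary X.
  move=> /subsetPn[m mM mX]; apply/subsetP => q /setIP[qX qQ].
  by rewrite inE qX; apply/subsetPn; exists m; rewrite ?inE ?QM.
have actM : ~~ (Q \subset X) -> X :&: M \subset boundary X.
  move=> /subsetPn[q qQ qX]; apply/subsetP => m /setIP[mX mM].
  by rewrite inE mX; apply/subsetPn; exists q; rewrite ?inE 1?adj_sym ?QM.
have cM : #|M :\: X| + #|X :&: M| = #|M| by rewrite setIC addnC cardsID.
have [QX|QX] := boolP (Q \subset X).
  move: XH; rewrite (setIidPr QX) => XH.
  have MX : ~~ (M \subset X) by rewrite -setD_eq0 -cards_eq0; lia.
  have := actQ MX; rewrite (setIidPr QX) => sQb.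
  have /eqP Qb : Q == boundary X by rewrite eqEcard sQb (leq_trans bX).
  have uQ : u \in Q.
    rewrite Qb inE uX; apply/subsetPn; exists v.
      by move: (set11 v); rewrite -Nu inE => /andP[].
    by move: (set11 v); rewrite -Nu inE => /andP[].
  have : #|M :\: X| <= #|[set v]|.
    rewrite -Nu; apply/subset_leq_card/setSD/subsetP => m mM.
    by rewrite inE QM.
  by rewrite cards1; lia.
have [MX|MX] := boolP (M \subset X).
  have := subset_leq_card (actM QX); rewrite (setIidPr MX); lia.
have : #|X :&: (Q :|: M)| <= #|boundary X|.
  by rewrite setIUr subset_leq_card // subUset actQ ?actM.
rewrite cQM; lia.
Qed.

(** Some fort avoids [S :\ s]; since [S] must meet it, they share exactly [s]. *)
Lemma minimal_private_fort S s :
    minimal_zero_forcing S -> s \in S ->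
  exists2 A : {set G}, A \subset ~: S & fort (s |: A).
Proof.
move=> /minsetP[zS minS] sS.
have /not_zero_forcing_fort[F fF dF] : ~~ zero_forcing (S :\ s).
  apply/negP => /minS/(_ (subD1set _ _)) E.
  by move: sS; rewrite -E !inE eqxx.
have sF : s \in F.
  apply: contraNT (fort_meets_zero_forcing zS fF) => sF.
  by rewrite -(setD1K sS) disjointsU1 sF.
exists (F :\ s); last by rewrite setD1K.
apply/subsetP => x /setD1P[xs xF]; rewrite inE.
by apply: contraTN xF => xS; rewrite (disjointFr dF) // !inE xs.
Qed.

(** * Vertices of a minimal zero forcing set and their traces on its complement *)

Section MinimalSet.
Variables S B : {set G}.
Hypotheses (minS : minimal_zero_forcing S) (zB : zero_forcing B).

Let W : {set G} := ~: S.
(* By private_adj, the neighbours of a vertex of few are determined by its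
   trace on W. *)
Let few : {set G} := [set v in S | #|nbhd v :&: W| <= 1].

(** A vertex of [few] sees at most one vertex of [A] and cannot see exactly one of the fort, so it
    sees [s] and one vertex of [A], or nothing of the fort. *)
Lemma private_adj A v s :
    v \in few -> v != s -> s \in S -> A \subset W -> fort (s |: A) ->
  adj v s = (nbhd v :&: A != set0).
Proof.
rewrite inE => /andP[vS vW] vs sS sAW /fortP[_ FP].
have vA : v \notin A.
  by apply/negP => /(subsetP sAW); rewrite inE vS.
have := FP v; rewrite !inE negb_or vs vA => /(_ isT) FPv.
have cA : #|nbhd v :&: A| <= 1.
  by apply: leq_trans vW; apply/subset_leq_card/setIS.
have sA : s \notin A.
  by apply/negP => /(subsetP sAW); rewrite inE sS.
move: FPv; rewrite setIUr cardsU -cards_eq0.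
have -> : nbhd v :&: [set s] :&: (nbhd v :&: A) = set0.
  by apply/setP => x; rewrite !inE; case: eqP => [->|]; rewrite ?(negPf sA) ?andbF.
rewrite cards0 subn0; case vsE: (adj v s).
  rewrite (setIidPr _) ?cards1; last by rewrite sub1set inE.
  by case: #|_|.
have -> : nbhd v :&: [set s] = set0.
  by apply/setP => x; rewrite !inE; case: eqP => [->|]; rewrite ?vsE ?andbF.
by rewrite cards0; case: #|_| cA => [|[]].
Qed.

(** By [private_adj], an empty trace leaves [v] no neighbour in [S] either, and an isolated vertex
    is a fort by itself. *)
Lemma few_isolated v : v \in few -> nbhd v :&: W = set0 -> v \in B.
Proof.
move=> vf vW; have vS : v \in S by move: vf; rewrite inE => /andP[].
suff /(fort_meets_zero_forcing zB) : fort [set v] by rewrite disjoint_sym disjoints1 negbK.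
have Nv y : adj y v = false.
  rewrite adj_sym; have [yS|yS] := boolP (y \in S); last first.
    apply/negP => vy; have : y \in nbhd v :&: W by rewrite !inE vy yS.
    by rewrite vW inE.
  have [->|vy] := eqVneq v y; first exact: adj_irrefl.
  have [A sAW fA] := minimal_private_fort minS yS.
  rewrite (private_adj vf vy yS sAW fA); apply/negbTE; rewrite negbK -subset0 -vW.
  exact: setIS.
apply/fortP; split; first by apply/set0Pn; exists v; rewrite set11.
move=> y _; suff -> : nbhd y :&: [set v] = set0 by rewrite cards0.
by apply/setP => x; rewrite !inE; case: eqP => [->|]; rewrite ?Nv ?andbF.
Qed.

(** Adjacency of [u] and of [v] to a further vertex of [S] is read off their traces through the same
    private fort. *)
Lemma few_twins u v :
    u \in few -> v \in few -> u != v -> nbhd u :&: W = nbhd v :&: W ->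
  fort [set u; v].
Proof.
move=> uf vf uv E; apply: twin_fort => // y yu yv.
rewrite ![adj y _]adj_sym; have [yS|yS] := boolP (y \in S); last first.
  by have /setP/(_ y) := E; rewrite !inE yS !andbT.
have [A sAW fA] := minimal_private_fort minS yS.
rewrite eq_sym in yu; rewrite eq_sym in yv.
rewrite (private_adj uf yu yS sAW fA) (private_adj vf yv yS sAW fA).
by rewrite -(setIidPr sAW) !setIA E.
Qed.

(** Outside [B], sending a vertex to its single neighbour in [W] is injective: two vertices with the
    same image would form a fort avoiding [B]. *)
Lemma few_card : #|few| <= #|B| + #|W|.
Proof.
rewrite -(cardsID B few); apply: leq_add.
  exact: subset_leq_card (subsetIr _ _).
have trace v : v \in few :\: B -> exists w, nbhd v :&: W = [set w].
  case/setDP=> vf vB; have: #|nbhd v :&: W| <= 1 by move: vf; rewrite inE => /andP[].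
  rewrite leq_eqVlt => /orP[/cards1P//|]; rewrite ltnS leqn0 cards_eq0 => /eqP.
  by move/(few_isolated vf); rewrite (negPf vB).
(* The default [v] never occurs on [few :\: B], where traces are nonempty. *)
pose f v := odflt v [pick w in nbhd v :&: W].
have fE v : v \in few :\: B -> nbhd v :&: W = [set f v].
  move/trace=> [w E]; rewrite /f E; case: pickP => [x|/(_ w)]; last by rewrite set11.
  by rewrite inE => /eqP->.
have injf : {in few :\: B &, injective f}.
  move=> u v uD vD fuv; apply/eqP/negPn/negP => uv.
  have [[uf uB] [vf vB]] : (u \in few /\ u \notin B) /\ (v \in few /\ v \notin B).
    by move: uD vD => /setDP ? /setDP ?.
  have := few_twins uf vf uv; rewrite !fE // fuv => /(_ erefl) /(fort_meets_zero_forcing zB).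
  by rewrite disjoint_sym disjointsU1 disjoints1 uB vB.
rewrite -(card_in_imset injf); apply/subset_leq_card/subsetP => _ /imsetP[v vD ->].
by have : f v \in nbhd v :&: W by [rewrite fE ?set11]; rewrite inE => /andP[].
Qed.

(** * Counting the vertices with at least two neighbours in [W] *)

Let many : {set G} := [set v in S | 1 < #|nbhd v :&: W|].

(** [#|W|] counts twice: for [W] itself and in the bound on [few]. *)
Lemma many_card : #|G| <= #|many| + #|B| + 2 * #|W|.
Proof.
have -> : many = S :\: few.
  by apply/setP => v; rewrite !inE ltnNge; case: (v \in S); rewrite ?andbT.
have := cardsID few S; have -> : S :&: few = few by apply/setIidPr/subsetP => v; rewrite inE => /andP[].
have := cardsC S; have := few_card; rewrite -/W; lia.
Qed.

(** In the uses, [C w] consists of common neighbours of a nonempty part of [W], and [biclique_bound]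
    gives the 2. *)
Lemma many_cover (W' : {set G}) (C : G -> {set G}) :
    (forall v, v \in many -> exists2 w, w \in W' & v \in C w) ->
    (forall w, w \in W' -> #|C w| <= 2) ->
  #|many| <= 2 * #|W'|.
Proof.
move=> cov C2; have sub : many \subset \bigcup_(w in W') C w.
  by apply/subsetP => v /cov[w wW vC]; apply/bigcupP; exists w.
apply: leq_trans (subset_leq_card sub) _.
apply: (leq_trans (n := \sum_(w in W') #|C w|)).
  elim/big_rec2: _ => [|w n X _ IH]; first by rewrite cards0.
  by rewrite (leq_trans (leq_card_setU _ _)) ?leq_add2l.
by rewrite mulnC -sum_nat_const; apply: leq_sum.
Qed.

(** Here [biclique_bound] limits all degrees to two. A vertex with two neighbours in [W] has one
    other than [w0], so three neighbourhoods suffice; using all four would give 8, and 8 + 1 + 8 is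
    not below 17. *)
Lemma many_card4 : #|W| = 4 -> #|B| <= 1 -> #|many| <= 6.
Proof.
move=> W4 B1; have [w0 w0W] : exists w, w \in W by apply/set0Pn; rewrite -cards_eq0 W4.
have -> : 6 = 2 * #|W :\ w0| by move: (cardsD1 w0 W); rewrite w0W; lia.
apply: (@many_cover _ (@nbhd G)) => [v|w _]; last first.
  apply: leq_trans (_ : maxn #|[set w]| 2 <= 2); last by rewrite cards1.
  apply: (biclique_bound zB); rewrite ?cards1 //.
  by move=> q m /set1P->; rewrite inE.
rewrite inE => /andP[_ v2].
have /set0Pn[w] : (nbhd v :&: W) :\ w0 != set0.
  by rewrite -cards_eq0; move: (cardsD1 w0 (nbhd v :&: W)); case: (_ \in _); lia.
by rewrite !inE => /and3P[? ? ?]; exists w; rewrite !inE; [apply/andP|rewrite adj_sym].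
Qed.

(** A vertex of [many] sees some pair [W :\ w], and each of the three pairs has at most two common
    neighbours. *)
Lemma many_card3 : #|W| = 3 -> #|B| <= 2 -> #|many| <= 6.
Proof.
move=> W3 B2; have -> : 6 = 2 * #|W| by rewrite W3.
apply: (@many_cover _ (fun w => [set v | W :\ w \subset nbhd v])) => [v|w wW].
  rewrite inE => /andP[_ v2].
  have /set0Pn[w] : W != set0 by rewrite -cards_eq0 W3.
  have [sub|/subsetPn[w' w'W w'N] _] := boolP (W \subset nbhd v) => [wW|].
    by exists w; rewrite // inE (subset_trans _ sub) ?subD1set.
  exists w'; rewrite // inE.
  have sub : nbhd v :&: W \subset W :\ w'.
    apply/subsetP => x /setIP[xN xW]; rewrite in_setD1 xW andbT.
    by apply: contraNneq w'N => <-.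
  have /eqP <- : nbhd v :&: W == W :\ w'.
    by rewrite eqEcard sub /=; move: (cardsD1 w' W); rewrite w'W; lia.
  exact: subsetIl.
have cW : #|W :\ w| = 2 by move: (cardsD1 w W); rewrite wW; lia.
apply: leq_trans (_ : maxn #|W :\ w| 2 <= 2); last by rewrite cW.
apply: (biclique_bound zB); rewrite ?cW // => q m qW.
by rewrite inE => /subsetP/(_ q qW); rewrite inE adj_sym.
Qed.

Lemma not_fort_complement : ~~ fort W.
Proof.
have /minsetP[zS _] := minS.
apply/negP => /(fort_meets_zero_forcing zS).
by rewrite disjoints_subset setCK subxx.
Qed.

(* Since W = {a,b} is not a fort, some x sees exactly one of them, say a.  A
   vertex c seeing both is either a twin of b or adjacent to x, as its private
   fort avoids or contains a; the latter form a biclique with {a,b,x}. *)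
Lemma many_card2 : #|W| = 2 -> #|B| <= 3 -> #|many| <= 7.
Proof.
move=> W2 B3.
have [x xS /eqP/cards1P[a xa]] : exists2 x, x \in S & #|nbhd x :&: W| = 1.
  move: not_fort_complement; rewrite /fort -cards_eq0 W2 /= negb_forall.
  by case/existsP=> x; rewrite negb_imply negbK inE negbK => /andP[xS /eqP]; exists x.
have /setIP[xNa aW] : a \in nbhd x :&: W by rewrite xa set11.
have [b Wa] : exists b, W :\ a = [set b].
  by apply/cards1P; move: (cardsD1 a W); rewrite aW W2 add1n => -[] <-.
have /setD1P[ba bW] : b \in W :\ a by rewrite Wa set11.
have WE : W = [set a; b] by rewrite -Wa setD1K.
have xb : ~~ adj x b.
  by apply: contra ba => xb; rewrite -in_set1 -xa !inE xb; rewrite inE in bW.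
have xf : x \in few by rewrite inE xS xa cards1.
have manyN c w : c \in many -> w \in W -> adj c w.
  rewrite inE => /andP[_ c2] wW.
  have /eqP E : nbhd c :&: W == W by rewrite eqEcard subsetIr W2.
  by move: wW; rewrite -E !inE => /andP[].
pose T := [set c in many | fort [set c; b]].
have Tb c : c \in T -> [/\ adj b c, c != b & forall y, y != c -> y != b -> adj y c = adj y b].
  rewrite inE => /andP[cm fc]; have cb : c != b.
    by apply: contraTneq bW => <-; move: cm; rewrite !inE negbK => /andP[].
  by split; [rewrite adj_sym manyN | | move=> y ? ?; apply: fort2_adj].
(* Twins of [b] are twins of one another, so [B] contains all of [T] but at most one vertex. *)
have cT : #|T| <= 4.
  rewrite -(cardsID B T); apply: (@leq_add _ _ 3 1).
    by apply: leq_trans B3; exact: subset_leq_card (subsetIr _ _).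
  rewrite leqNgt; apply/negP => /card_gt1P[u [v [/setDP[uT uB] /setDP[vT vB] uv]]].
  have [bu ub uP] := Tb u uT; have [bv vb vP] := Tb v vT.
  have /(fort_meets_zero_forcing zB) : fort [set u; v].
    apply: twin_fort => // y yu yv; have [->|yb] := eqVneq y b; first by rewrite bu bv.
    by rewrite uP ?vP.
  by rewrite disjoint_sym disjointsU1 disjoints1 uB vB.
have xa' : x != a by apply: contraTneq xS => ->; rewrite inE in aW.
have xb' : x != b by apply: contraTneq xS => ->; rewrite inE in bW.
have cQ : #|[set x; a; b]| = 3.
  by rewrite -setUA cardsU1 cards2 !inE negb_or xa' xb' eq_sym ba.
have cM : #|many :\: T| <= 3.
  apply: leq_trans (_ : maxn #|[set x; a; b]| 2 <= 3); last by rewrite cQ.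
  apply: (biclique_bound zB); rewrite ?cQ // => q c qQ /setDP[cm cnT].
  move: qQ; rewrite !inE => /orP[/orP[]|] /eqP->; last 2 first.
  - by rewrite adj_sym manyN.
  - by rewrite adj_sym manyN.
  have cS : c \in S by move: cm; rewrite inE => /andP[].
  have [A sAW fA] := minimal_private_fort minS cS.
  have xc : x != c.
    by apply: contraTneq cm => <-; rewrite inE xa cards1 andbF.
  rewrite (private_adj xf xc cS sAW fA).
  have [aA|aA] := boolP (a \in A); first by apply/set0Pn; exists a; rewrite inE xNa.
  (* Without [a], the private fort is [[set c; b]], which puts [c] in [T], or [[set c]], which is no
     fort because [a] sees [c]. *)
  have sAb : A \subset [set b].
    by rewrite -Wa; apply/subsetP => y yA; rewrite in_setD1 (subsetP sAW) // andbT; apply: contraNneq aA => <-.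
  move: fA; move: sAb; rewrite subset1 => /orP[] /eqP->.
    by rewrite setUC => fc; case/negP: cnT; rewrite inE cm setUC.
  rewrite setU0 => /fortP[_ /(_ a)]; rewrite inE.
  have ca : a != c by apply: contraTneq aW => ->; rewrite inE cS.
  move/(_ ca); case; apply/eqP/cards1P; exists c.
  by apply/setIidPr; rewrite sub1set inE adj_sym manyN.
have := cardsID T many; have : #|many :&: T| <= #|T| by exact: subset_leq_card (subsetIr _ _).
lia.
Qed.

(** If the sum is at most 5, then [#|W| <= 4], as [B] is nonempty. For [#|W|] at most 1, or equal to
    2, 3, 4, [many_card] bounds the order by 6, 14, 14, 15. *)
Lemma minimal_card_bound : 17 <= #|G| -> 6 <= #|B| + #|W|.
Proof.
move=> n17; rewrite leqNgt ltnS; apply/negP => BW.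
have cm := many_card.
have m0 : #|W| <= 1 -> #|many| = 0.
  move=> W1; apply/eqP; rewrite cards_eq0 -subset0; apply/subsetP => v.
  rewrite inE ltnNge => /andP[_]; rewrite (leq_trans _ W1) //.
  exact: subset_leq_card (subsetIr _ _).
have B0 : 0 < #|B|.
  rewrite card_gt0; apply: contraTneq n17 => B0.
  have E : set0 = [set: G].
    apply: (zero_forcing_stable zB); first by rewrite B0.
    by move=> u v; rewrite /forces inE.
  by rewrite -cardsT -E cards0.
have [] : #|W| <= 1 \/ #|W| = 2 \/ #|W| = 3 \/ #|W| = 4 by lia.
  by move=> W1; have := m0 W1; lia.
case=> [W2|[W3|W4]].
- have := many_card2 W2; lia.
- have := many_card3 W3; lia.
- have := many_card4 W4; lia.
Qed.

End MinimalSet.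

(** * The upper bound on [md] *)

Lemma zero_forcing_number_le B : zero_forcing B -> Z G <= #|B|.
Proof.
by rewrite /Z; case: arg_minnP => [|S zS minS /minS//]; exact: zero_forcing_setT.
Qed.

Lemma minimal_zero_forcing_le S : minimal_zero_forcing S -> #|S| <= Zbar G.
Proof. by move=> mS; rewrite /Zbar (bigD1 S) //= leq_maxl. Qed.

Lemma md_bound : 17 <= graph_order G -> md G <= graph_order G - 6.
Proof.
rewrite /graph_order /md => n17.
have [B zB <-] : exists2 B : {set G}, zero_forcing B & #|B| = Z G.
  rewrite /Z; case: arg_minnP => [|B zB _]; first exact: zero_forcing_setT.
  by exists B.
(* For a minimal [S] with complement [W], [#|S| - #|B|] is the order minus [#|B| + #|W|]. *)
suff : Zbar G <= #|G| - 6 + #|B| by lia.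
rewrite /Zbar; apply/bigmax_leqP => S mS; have := minimal_card_bound mS zB n17.
have := cardsC S; lia.
Qed.

End Forts.

(** * Sharpness: an infinite family of fans *)

Section Family.
Variable i : nat.

(** The numbers 0, 1, 2 stand for a, b, x, and the path starts at 3. The disjuncts are the join, the
    path and the edge ax. *)
Definition fan_edge (u v : nat) : bool :=
  [|| (u < 3) && (2 < v), (2 < u) && (v == u.+1) | (u == 0) && (v == 2)].

Definition fan_adj : rel 'I_(17 + i) := fun u v => fan_edge u v || fan_edge v u.

Lemma fan_adj_sym : symmetric fan_adj.
Proof. by move=> u v; rewrite /fan_adj orbC. Qed.

Lemma fan_adj_irrefl : irreflexive fan_adj.
Proof. by move=> u; rewrite /fan_adj /fan_edge; lia. Qed.

Definition fan : sgraph := SGraph fan_adj_sym fan_adj_irrefl.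

Lemma fan_order : graph_order fan = 17 + i.
Proof. exact: card_ord. Qed.


Definition low (m : nat) : {set fan} := [set u : 'I_(17 + i) | u < m].

Lemma card_low m : m <= 17 -> #|low m| = m.
Proof.
move=> m17; have lemn : m <= 17 + i by lia.
have -> : low m = [set widen_ord lemn j | j : 'I_m].
  apply/setP => u; rewrite inE; apply/idP/imsetP => [um|[j _ ->]]; last exact: (ltn_ord j).
  by exists (Ordinal um) => //; apply: val_inj.
rewrite card_imset ?card_ord // => j k /(congr1 val) /= jk; exact: val_inj.
Qed.

(* A fort avoiding 0, 1, 2, 3 has a least element v, whose predecessor on the
   path then sees only v in the fort. *)
Lemma low4_zero_forcing : zero_forcing (low 4).
Proof.
apply/negPn/negP => /not_zero_forcing_fort[F /fortP[/set0Pn[x0 x0F] FP] dF].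
have [v vF vmin] : exists2 v : 'I_(17 + i), v \in F & forall y : 'I_(17 + i), y \in F -> v <= y.
  by case: (arg_minnP (fun y : 'I_(17 + i) => nat_of_ord y) x0F) => v; exists v.
have F4 (y : 'I_(17 + i)) : y \in F -> 4 <= y.
  by move=> yF; rewrite leqNgt; have := disjointFl dF yF; rewrite inE => ->.
have v4 := F4 v vF; have vn := ltn_ord v.
have un : v.-1 < 17 + i by lia.
apply: (FP (Ordinal un)); first by apply/negP => /vmin /=; lia.
apply/eqP/cards1P; exists v; apply/setP => y; rewrite !inE /= /fan_adj /fan_edge /=.
apply/andP/eqP => [[uy yF]|->]; last by split; [lia|].
apply: val_inj => /=; have := vmin y yF; have := F4 y yF; lia.
Qed.

(** A fort avoiding this set lies in [[set a; b]]; vertex 2 sees only [a] there, which excludes [a],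
    and then vertex 3 excludes [b]. *)
Lemma low2_complement_minimal : minimal_zero_forcing (~: low 2).
Proof.
have n0 : 0 < 17 + i by []. have n1 : 1 < 17 + i by [].
have n2 : 2 < 17 + i by []. have n3 : 3 < 17 + i by [].
pose a : fan := Ordinal n0. pose b : fan := Ordinal n1.
have lowE (y : fan) : (y \in low 2) = (y == a) || (y == b).
  by rewrite inE -!val_eqE /=; case: y => -[|[|]].
apply/minsetP; split=> [|B zB sB].
  apply/negPn/negP => /not_zero_forcing_fort[F /fortP[/set0Pn[x xF] FP]].
  rewrite disjoint_sym disjoints_subset setCK => /subsetP sF.
  have F2 (y : 'I_(17 + i)) : y \in F -> y < 2 by move/sF; rewrite inE.
  have aF : a \notin F.
    apply/negP => aF; apply: (FP (Ordinal n2)); first by apply/negP => /F2.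
    apply/eqP/cards1P; exists a; apply/setP => y; rewrite !inE /= /fan_adj /fan_edge /=.
    apply/andP/eqP => [[uy /F2 yF]|->]; last by split.
    by apply: val_inj => /=; lia.
  have FE y : y \in F -> y = b.
    by move=> yF; have := sF y yF; rewrite lowE => /orP[/eqP ya|/eqP//]; rewrite -ya yF in aF.
  apply: (FP (Ordinal n3)); first by apply/negP => /F2.
  apply/eqP/cards1P; exists b; apply/setP => y; rewrite !inE.
  apply/andP/eqP => [[_ /FE]//|->]; by rewrite -(FE x xF) xF (FE x xF).
apply/eqP; rewrite eqEsubset sB; apply/subsetP => s sS; apply/negPn/negP => sNB.
(* This fort makes each [s] indispensable: path vertices other than [s] see both [a] and [b], and
   vertex 2, if it is not [s], sees [a] and [s]. *)
have fF : fort (s |: low 2).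
  apply/fortP; split; first by apply/set0Pn; exists s; rewrite setU11.
  move=> v; rewrite in_setU1 negb_or => /andP[vs vl] N1.
  have v2 : 1 < (v : 'I_(17 + i)) by move: vl; rewrite inE; lia.
  have s2 : 1 < (s : 'I_(17 + i)) by move: sS; rewrite !inE; lia.
  have vs' : nat_of_ord v != nat_of_ord s by [].
  have : 1 < #|nbhd v :&: (s |: low 2)|; last by rewrite N1.
  apply/card_gt1P.
  have [v3|v3] := ltnP 2 (v : 'I_(17 + i)).
    exists a, b; split=> //; rewrite !inE /= /fan_adj /fan_edge /= ?orbT ?andbT; lia.
  exists a, s; split.
  - by rewrite !inE /= /fan_adj /fan_edge /= ?orbT ?andbT; lia.
  - by rewrite !inE eqxx /= /fan_adj /fan_edge /= ?orbT ?andbT; lia.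
  - by apply: contraTneq s2 => <-.
have := fort_meets_zero_forcing zB fF; rewrite disjoint_sym disjointsU1 sNB /=.
by rewrite disjoint_sym disjoints_subset sB.
Qed.

(** The two explicit sets give [Zbar] at least the order minus 2, and [Z] at most 4. *)
Lemma fan_md : md fan = graph_order fan - 6.
Proof.
apply/eqP; rewrite eqn_leq md_bound ?fan_order //=.
have := zero_forcing_number_le low4_zero_forcing; rewrite card_low //.
have := minimal_zero_forcing_le low2_complement_minimal.
have := cardsC (low 2); rewrite card_low // -[#|fan|]/(graph_order fan) fan_order.
rewrite /md; lia.
Qed.

End Family.

Theorem theorem3p16 :
  (forall G : sgraph, 17 <= graph_order G -> md G <= graph_order G - 6) /\
  (exists F : nat -> sgraph,
     (forall i : nat, 17 <= graph_order (F i) /\ md (F i) = graph_order (F i) - 6) /\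
     (forall i j : nat, i <> j -> ~ isomorphic (F i) (F j))).
Proof.
split; first exact: md_bound.
exists fan; split=> [i|i j ij [f /bij_eq_card]].
  by split; [rewrite fan_order | exact: fan_md].
by rewrite -[#|fan i|]/(graph_order _) -[#|fan j|]/(graph_order _) !fan_order => /addnI.
Qed.
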